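(* Let $m\ge 2$ be an integer and let $0<p\le 1/2$. Suppose there is a sequence of proper $(2,m)$ CSS codes whose rates converge to $R$ and whose decoding error probability $P_{err}$ over the quantum erasure channel of erasure probability $p$ tends to $0$ (that is, $R$ is an achievable rate of proper $(2,m)$ CSS codes). Then $$R\le (1-2p)\left(\frac{4}{mp}\Big(1-(1-p)^m S_{m-2}\big(p(1-p)^{m-2}\big)\Big)-1\right),$$ where $S_{m-2}(z)=\sum_{k=0}^{m-2}\frac{a_k}{k+1}z^k$ and $a_k$ is the number of subtrees with $k$ edges of the infinite $m$-regular tree that contain a fixed vertex.
   Context: A binary matrix is of type $(2,m)$ if every row has weight $m$ and every column has weight $2$. Such a matrix is the incidence matrix of an $m$-regular graph: vertices are the rows, edges are the columns, and the column $j$ joins the two rows having a $1$ in column $j$ (parallel edges are allowed a priori). A $(2,m)$ CSS code of length $n$ is given by two binary matrices $\mathbf H_X,\mathbf H_Z$ with $n$ columns, both of type $(2,m)$, such that every row of $\mathbf H_X$ is orthogonal in $\mathbb F_2^n$ to every row of $\mathbf H_Z$. Let $G_X,G_Z$ be the associated graphs. The code is proper if $G_X$ and $G_Z$ are connected and both have girth (smallest cycle length) equal to $m$. The rate is $k/n$ with $k=n-\operatorname{rank}\mathbf H_X-\operatorname{rank}\mathbf H_Z$. As a stabilizer code: Pauli operators modulo phase on $n$ qubits are identified with pairs $(E_X,E_Z)\in\mathbb F_2^n\times\mathbb F_2^n$. The stabilizer group is $S=\operatorname{row}(\mathbf H_X)\times\operatorname{row}(\mathbf H_Z)$ and the syndrome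 of $E=(E_X,E_Z)$ is $\sigma(E)=(\mathbf H_Z\,{}^tE_X,\ \mathbf H_X\,{}^tE_Z)$. Quantum erasure channel of probability $p$: the erasure $\mathcal E\in\mathbb F_2^n$ is random with i.i.d. Bernoulli($p$) coordinates; given $\mathcal E$, the error $E=(E_X,E_Z)$ is uniform among pairs with both $E_X$ and $E_Z$ supported in the support of $\mathcal E$. The decoder sees $(\mathcal E,\sigma(E))$ and must determine the coset $E+S$. $P_{err}$ is the probability that the best possible estimate of $E+S$, as a function of $(\mathcal E,\sigma(E))$, is wrong. *)

(* Defs.v *)
From mathcomp Require Import all_boot all_order all_algebra finmap.
From mathcomp Require Import boolp classical_sets functions cardinality reals.
From mathcomp Require Import topology normedtype sequences.

Set Implicit Arguments.
Unset Strict Implicit.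
Unset Printing Implicit Defensive.

Import Order.TTheory GRing.Theory Num.Theory.
Import numFieldNormedType.Exports.

Local Open Scope ring_scope.

Section Graph.
Variables (r n : nat) (H : 'M['F_2]_(r, n)).

Definition type2 (m : nat) : bool :=
  [forall i, #|[set j | H i j != 0]| == m] &&
  [forall j, #|[set i | H i j != 0]| == 2].

Definition joins (e : 'I_n) (u v : 'I_r) : bool :=
  [&& u != v, H u e != 0 & H v e != 0].

Definition graph_adj : rel 'I_r := [rel u v | [exists e, joins e u v]].

Definition graph_connected : Prop :=
  (0 < r)%N /\ forall u v, connect graph_adj u v.

(* [ordS] is the cyclic successor of 'I_l. Edges are required to be distinct,
   so that two parallel edges form a cycle of length 2 but a single edge
   traversed back and forth does not. *)
Definition has_cycle (l : nat) : Prop :=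
  (0 < l)%N /\
  exists (v : 'I_l -> 'I_r) (e : 'I_l -> 'I_n),
    [/\ injective v, injective e & forall i, joins (e i) (v i) (v (ordS i))].

Definition has_girth (g : nat) : Prop :=
  has_cycle g /\ forall l, has_cycle l -> (g <= l)%N.

End Graph.

Record css_code (m : nat) := CSSCode {
  len : nat;
  nX : nat;
  nZ : nat;
  HX : 'M['F_2]_(nX, len);
  HZ : 'M['F_2]_(nZ, len);
  HX_type : type2 HX m;
  HZ_type : type2 HZ m;
  HXZ_orth : HX *m HZ^T = 0
}.

Definition proper (m : nat) (C : css_code m) : Prop :=
  [/\ graph_connected (HX C), graph_connected (HZ C),
      has_girth (HX C) m & has_girth (HZ C) m].

(* The subtractions take place in R, so they are not truncated. *)
Definition rate (R : realType) (m : nat) (C : css_code m) : R :=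
  ((len C)%:R - (\rank (HX C))%:R - (\rank (HZ C))%:R) / (len C)%:R.

Section ErasureChannel.
Variables (R : realType) (m : nat) (C : css_code m) (p : R).

Local Notation vec := 'rV['F_2]_(len C).
Local Notation pauli := (vec * vec)%type.
Local Notation synd := ('cV['F_2]_(nZ C) * 'cV['F_2]_(nX C))%type.

Definition stabilizer : {set pauli} :=
  [set E | (E.1 <= HX C)%MS && (E.2 <= HZ C)%MS].

Definition stab_coset (E : pauli) : {set pauli} :=
  [set E + s | s in stabilizer].

Definition syndrome (E : pauli) : synd := (HZ C *m E.1^T, HX C *m E.2^T).

Definition supp (x : vec) : {set 'I_(len C)} := [set j | x 0 j != 0].

Definition erasure_prob (x : vec) : R :=
  \prod_(j < len C) (if x 0 j != 0 then p else 1 - p).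

Definition erased_errors (x : vec) : {set pauli} :=
  [set E | (supp E.1 \subset supp x) && (supp E.2 \subset supp x)].

(* Estimates range over all sets of Pauli operators; one that is not a coset of
   the stabilizer is always wrong. *)
Definition decoder := {ffun vec * synd -> {set pauli}}.

Definition wrong_errors (D : decoder) (x : vec) : {set pauli} :=
  [set E in erased_errors x | D (x, syndrome E) != stab_coset E].

Definition decoder_error (D : decoder) : R :=
  \sum_(x : vec)
    erasure_prob x * (#|wrong_errors D x|%:R / #|erased_errors x|%:R).

(* The default value 1 is harmless: for p in [0, 1] every decoder_error is at
   most 1. *)
Definition Perr : R := \big[Num.min/1]_(D : decoder) decoder_error D.

End ErasureChannel.

Definition achievable_rate (R : realType) (m : nat) (p r : R) : Prop :=
  exists C : nat -> css_code m,
    [/\ forall i, proper (C i),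
        ((fun i => rate R (C i)) @ \oo --> r)%classic
      & ((fun i => Perr (C i) p) @ \oo --> (0 : R))%classic].

Section RegularTree.
Variable m : nat.

(* The m-regular tree as the Cayley graph of the free product of m copies of
   Z/2: vertices are the words over 'I_m without two equal consecutive letters,
   and c :: w is adjacent to w. It is vertex-transitive, so the empty word can
   serve as the fixed vertex. *)
Definition tree_vertex := {w : seq 'I_m | sorted [rel a b | a != b] w}.

Definition tree_root : tree_vertex := exist _ [::] isT.

Definition tree_parent : rel tree_vertex :=
  [rel u v | (val v != [::]) && (behead (val v) == val u)].

Definition tree_adj : rel tree_vertex :=
  [rel u v | tree_parent u v || tree_parent v u].

(* A subtree is given by its vertex set: its edges are the tree edges between
   its vertices, each listed once, from parent to child. *)
Definition subtree_edges (T : {fset tree_vertex}) :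
    {fset tree_vertex * tree_vertex} :=
  [fset e in (T `*` T)%fset | tree_parent e.1 e.2]%fset.

Definition rooted_subtree (k : nat) (T : {fset tree_vertex}) : Prop :=
  [/\ tree_root \in T,
      forall u v : T, connect (fun x y : T => tree_adj (val x) (val y)) u v
    & #|` subtree_edges T| = k].

Lemma subtree_ancestors (k : nat) (T : {fset tree_vertex}) (v : tree_vertex) :
  rooted_subtree k T -> v \in T ->
  forall i, exists2 u : tree_vertex, u \in T & val u = drop i (val v).
Proof.
case=> rT conT _ vT.
have [y ->] : exists y : T, v = val y by exists [` vT]%fset.
case/connectP: (conT [` rT]%fset y) => q pq ->.
elim/last_ind: q pq {v vT y conT} => [_ i|q x IHq].
  by exists tree_root => //=; case: i.
rewrite rcons_path last_rcons => /andP[/IHq{}IHq].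
set z := last _ _ in IHq * => /orP[|] /andP[ne /eqP beh] i.
- case: i => [|i]; first by exists (val x); rewrite ?drop0 ?fsvalP.
  have [u uT uE] := IHq i; exists u => //.
  by rewrite uE -beh -drop1 drop_drop addn1.
- have [u uT uE] := IHq i.+1; exists u => //.
  by rewrite uE -beh -drop1 drop_drop addn1.
Qed.

Lemma subtree_depth (k : nat) (T : {fset tree_vertex}) (v : tree_vertex) :
  rooted_subtree k T -> v \in T -> (size (val v) <= k)%N.
Proof.
move=> stT vT; have anc := subtree_ancestors stT vT.
have [_ _ <-] := stT.
rewrite -(size_iota 1 (size (val v))).
rewrite -(size_map (fun e : tree_vertex * tree_vertex => size (val e.2))).
apply: uniq_leq_size => [|j]; first exact: iota_uniq.
rewrite mem_iota add1n ltnS => /andP[j0 jv].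
have [w wT wE] := anc (size (val v) - j)%N.
have [u uT uE] := anc (size (val v) - j).+1.
have sw : size (val w) = j by rewrite wE size_drop subKn.
apply/mapP; exists (u, w); last by rewrite /= sw.
rewrite !inE /= uT wT /=; apply/andP; split.
  by rewrite -size_eq0 sw -lt0n.
by rewrite uE wE -drop1 drop_drop add1n.
Qed.

Lemma rooted_subtrees_finite (k : nat) :
  finite_set [set T | rooted_subtree k T]%classic.
Proof.
pose s : seq tree_vertex :=
  pmap insub [seq bseqval b | b <- enum {: k.-bseq 'I_m}].
pose F : {fset tree_vertex} := [fset x in s]%fset.
apply: (@sub_finite_set _ _ [set` fpowerset F]%classic); last first.
  exact: finite_fset.
move=> T stT /=; rewrite fpowersetE; apply/fsubsetP => v vT.
rewrite !inE mem_pmap_sub; apply/mapP.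
have vk := subtree_depth stT vT.
by exists (Bseq vk); rewrite ?mem_enum.
Qed.

(* [fset_set] is the empty set on infinite sets, a case excluded by
   [rooted_subtrees_finite]. *)
Definition num_subtrees (k : nat) : nat :=
  #|` fset_set [set T | rooted_subtree k T]%classic|.

End RegularTree.

Definition Spoly (R : realType) (m d : nat) (z : R) : R :=
  \sum_(k < d.+1) (num_subtrees m k)%:R / k.+1%:R * z ^+ k.

(* Main.v *)
(* For an erasure pattern A, an undetected non-stabilizer error supported in A
   pairs each correctly decoded error with a wrongly decoded one, so P_err is at
   least half the probability that such an error exists. When there is none,
   every vector of ker H_Z supported in A lies in row H_X, and likewise with X
   and Z exchanged; comparing dimensions gives, with
   rho(p) = E[rank (H_X)_A + rank (H_Z)_A] / n,
     2p - rho(p) - (1 - rate) + rho(1 - p) <= 4 P_err.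
   Submodularity of the rank makes rho concave enough that
     (1 - p) rho(1 - p) >= p rho(p) + (1 - 2p) (1 - rate),
   and therefore rate <= (1 - 2p) (rho(p) / p - 1) + O(P_err).
   Finally, rank (H_X)_A is at most the number of vertices minus the number of
   components of the graph with edge set A, that is, minus the sum over the
   vertices v of 1 / |component of v|. A component of v that is a tree with
   k <= m - 2 edges is the image of a unique rooted subtree of the m-regular
   tree under the universal covering, because the girth is m; each of these
   a_k images occurs with probability at least
   p^k (1 - p)^(m (k + 1) - 2 k). *)

Require Import Defs.
From mathcomp Require Import all_boot all_order all_algebra finmap.
From mathcomp Require Import boolp classical_sets functions cardinality reals.
From mathcomp Require Import topology normedtype sequences.
(* The finite-set versions of [subsetP], [setP] and others take precedence over
   the classical-set ones. *)
From mathcomp Require Import bigop fintype finset perm finmap ring lra zify.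

Import Order.TTheory GRing.Theory Num.Theory.
Import numFieldNormedType.Exports.
Local Open Scope ring_scope.

Set Implicit Arguments.
Unset Strict Implicit.
Unset Printing Implicit Defensive.

(** * Bernoulli random subsets *)

Section Bernoulli.
Variables (R : realType) (I : finType).
Implicit Types (p q : R) (A B D : {set I}).

Definition bern p A : R := \prod_i (if i \in A then p else 1 - p).

Lemma bern_ge0 p A : 0 <= p <= 1 -> 0 <= bern p A.
Proof.
move=> /andP[p0 p1]; apply: prodr_ge0 => i _.
by case: ifP => _ //; rewrite subr_ge0.
Qed.

Lemma bern_cylinder p B D : D \subset B ->
  \sum_A bern p A * (A :&: B == D)%:R = p ^+ #|D| * (1 - p) ^+ (#|B| - #|D|).
Proof.
move=> DB.
(* [F i] weighs [i \in A] and [G i] weighs [i \notin A], each replaced by 0 where it contradicts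
   [A :&: B = D]. *)
pose F i : R := if i \in B then (if i \in D then p else 0) else p.
pose G i : R := if i \in D then 0 else 1 - p.
transitivity (\prod_i (F i + G i)).
  rewrite bigA_distr; apply: eq_bigr => A _.
  have [eqD|neD] := eqVneq (A :&: B) D.
    rewrite mulr1; apply: eq_bigr => i _; rewrite /F /G -eqD !inE.
    by case: (i \in A); case: (i \in B).
  rewrite mulr0.
  have [i] : exists i, (i \in A :&: B) != (i \in D).
    apply/existsP; apply: contra_neqT neD; rewrite negb_exists.
    by move/forallP => h; apply/setP => i; apply/eqP; rewrite -[_ == _]negbK h.
  rewrite inE => hi; apply/esym/eqP/prodf_eq0; exists i => //.
  rewrite /F /G; have := subsetP DB i.
  by move: hi; case: (i \in A); case: (i \in B); case: (i \in D) => //= _ /(_ isT).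
rewrite (bigID (mem B)) /= [X in _ * X]big1 ?mulr1; last first.
  move=> i nB; rewrite /F /G (negbTE nB).
  by rewrite (contraNF (subsetP DB i) nB) addrC subrK.
rewrite (bigID (mem D)) /=; congr (_ * _).
  rewrite -prodr_const; apply: eq_big => i; last first.
    by case/andP => iB iD; rewrite /F /G iB iD addr0.
  by rewrite andbC; case: (boolP (i \in D)) => // /(subsetP DB) ->.
have -> : (#|B| - #|D|)%N = #|B :\: D| by rewrite cardsD (setIidPr DB).
rewrite -prodr_const; apply: eq_big => i.
  by rewrite !inE andbC.
by case/andP => iB /negbTE iD; rewrite /F /G iB iD add0r.
Qed.

Lemma bern_total p : \sum_A bern p A = 1.
Proof.
rewrite -[RHS](_ : p ^+ #|@set0 I| * (1 - p) ^+ (#|@set0 I| - #|@set0 I|) = 1).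
  rewrite -bern_cylinder ?sub0set //.
  by apply: eq_bigr => A _; rewrite setI0 eqxx mulr1.
by rewrite cards0 mul1r.
Qed.

Lemma bern_mem p i : \sum_A bern p A * (i \in A)%:R = p.
Proof.
transitivity (p ^+ #|[set i]| * (1 - p) ^+ (#|[set i]| - #|[set i]|)).
  rewrite -bern_cylinder //; apply: eq_bigr => A _; congr (_ * (nat_of_bool _)%:R).
  apply/idP/eqP => [iA|/setP/(_ i)]; last by rewrite !inE eqxx andbT.
  by apply/setIidPr; rewrite sub1set.
by rewrite subnn cards1 expr0 mulr1 expr1.
Qed.

Lemma bern_setC p (g : {set I} -> R) :
  \sum_A bern p A * g (~: A) = \sum_A bern (1 - p) A * g A.
Proof.
rewrite (reindex_inj (inv_inj (@setCK I))); apply: eq_bigr => A _; rewrite setCK.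
congr (_ * _); apply: eq_bigr => i _; rewrite inE subKr.
by case: (i \in A).
Qed.

(** A point is missed by both independent sets with probability [(1 - p) * (1 - q)]. *)
Lemma bern_setU p q (g : {set I} -> R) :
  \sum_A \sum_D bern p A * bern q D * g (A :|: D) =
  \sum_B bern (1 - (1 - p) * (1 - q)) B * g B.
Proof.
(* [h A i b] is the probability, given [A], that the membership of [i] in [A :|: D] is [b]. *)
pose h A i (b : bool) : R := if i \in A then b%:R else if b then q else 1 - q.
have inner A B : \sum_D bern q D * (A :|: D == B)%:R = \prod_i h A i (i \in B).
  pose F i : R := if i \in B then q else 0.
  pose G i : R := if (i \in A) == (i \in B) then 1 - q else 0.
  transitivity (\prod_i (F i + G i)); last first.
    apply: eq_bigr => i _; rewrite /F /G /h.
    by case: (i \in A); case: (i \in B) => /=; ring.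
  rewrite bigA_distr; apply: eq_bigr => D _.
  have [eqB|neB] := eqVneq (A :|: D) B.
    rewrite mulr1; apply: eq_bigr => i _; rewrite /F /G -eqB !inE.
    by case: (i \in D); case: (i \in A).
  rewrite mulr0.
  have [i] : exists i, (i \in A :|: D) != (i \in B).
    apply/existsP; apply: contra_neqT neB; rewrite negb_exists.
    by move/forallP => hh; apply/setP => i; apply/eqP; rewrite -[_ == _]negbK hh.
  rewrite inE => hi; apply/esym/eqP/prodf_eq0; exists i => //.
  rewrite /F /G.
  by move: hi; case: (i \in A); case: (i \in B); case: (i \in D).
have outer B : \sum_A bern p A * \prod_i h A i (i \in B) =
    bern (1 - (1 - p) * (1 - q)) B.
  pose F i : R := p * (i \in B)%:R.
  pose G i : R := (1 - p) * (if i \in B then q else 1 - q).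
  transitivity (\prod_i (F i + G i)); last first.
    by apply: eq_bigr => i _; rewrite /F /G; case: (i \in B) => /=; ring.
  rewrite bigA_distr; apply: eq_bigr => A _; rewrite -big_split /=.
  by apply: eq_bigr => i _; rewrite /h /F /G; case: (i \in A).
transitivity (\sum_B \sum_A \sum_D
    bern p A * bern q D * (A :|: D == B)%:R * g B).
  rewrite [RHS]exchange_big /=; apply: eq_bigr => A _.
  rewrite [RHS]exchange_big /=.
  apply: eq_bigr => D _; rewrite (bigD1 (A :|: D)) //= eqxx mulr1 big1 ?addr0 //.
  by move=> B /negbTE nB; rewrite eq_sym nB mulr0 mul0r.
apply: eq_bigr => B _; rewrite -outer mulr_suml; apply: eq_bigr => A _.
rewrite -inner mulr_sumr mulr_suml; apply: eq_bigr => D _.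
by rewrite !mulrA.
Qed.

End Bernoulli.

(** * Ranks of column subsets *)

Section RankFunction.
Variables (F : fieldType) (n : nat).
Implicit Types (A B D : {set 'I_n}).

(** A projection with two uses: its row space is the space of vectors supported in [A], and
    multiplication by it on the left zeroes the rows outside [A]. *)
Definition coord_mx A : 'M[F]_n := diag_mx (\row_j (j \in A)%:R).

Lemma coord_mxE A r (M : 'M[F]_(n, r)) i j :
  (coord_mx A *m M) i j = (i \in A)%:R * M i j.
Proof. by rewrite mul_diag_mx !mxE. Qed.

Lemma coord_mx_sub A r (u : 'M[F]_(r, n)) :
  reflect (forall i j, j \notin A -> u i j = 0) (u <= coord_mx A)%MS.
Proof.
apply: (iffP submxP) => [[D ->] i j jA|u0].
  by rewrite /coord_mx mul_mx_diag !mxE (negbTE jA) mulr0.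
exists u; rewrite /coord_mx mul_mx_diag; apply/matrixP => i j; rewrite !mxE.
by have [jA|/u0 ->] := boolP (j \in A); rewrite ?mulr1 ?mul0r.
Qed.

Lemma row_coord_mx A r (M : 'M[F]_(n, r)) i :
  row i (coord_mx A *m M) = (i \in A)%:R *: row i M.
Proof. by apply/rowP => j; rewrite mxE coord_mxE !mxE. Qed.

Lemma coord_mxS A B r (M : 'M[F]_(n, r)) :
  A \subset B -> (coord_mx A *m M <= coord_mx B *m M)%MS.
Proof.
move=> AB; apply/row_subP => i; rewrite row_coord_mx.
have [iA|_] := boolP (i \in A); last by rewrite scale0r sub0mx.
apply: (submx_trans _ (row_sub i _)); rewrite row_coord_mx.
by rewrite (subsetP AB).
Qed.

Lemma coord_mxU A B r (M : 'M[F]_(n, r)) :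
  (coord_mx (A :|: B) *m M :=: coord_mx A *m M + coord_mx B *m M)%MS.
Proof.
apply/eqmxP/andP; split; last by rewrite addsmx_sub !coord_mxS ?subsetUl ?subsetUr.
apply/row_subP => i; rewrite row_coord_mx inE.
have [iA|_] := boolP (i \in A).
  apply: submx_trans (addsmxSl _ _); apply: (submx_trans _ (row_sub i _)).
  by rewrite row_coord_mx iA.
apply: submx_trans (addsmxSr _ _); apply: (submx_trans _ (row_sub i _)).
by rewrite row_coord_mx.
Qed.

(** The row spaces for [A] and its complement add up to the whole space, so the upper bounds [#|A|]
    and [#|~: A|] are both attained. *)
Lemma rank_coord_mx A : \rank (coord_mx A) = #|A|.
Proof.
have leA B : (\rank (coord_mx B) <= #|B|)%N.
  apply: (@leq_trans (\rank (rowsub (@enum_val _ (mem B)) (1%:M : 'M[F]_n)))).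
    apply: mxrankS; apply/row_subP => i.
    rewrite -[coord_mx B]mulmx1 row_coord_mx.
    have [iB|_] := boolP (i \in B); last by rewrite scale0r sub0mx.
    rewrite scale1r -(enum_rankK_in iB iB) -row_rowsub; exact: row_sub.
  exact: rank_leq_row.
apply/eqP; rewrite eqn_leq leA /=.
rewrite -(leq_add2r #|~: A|) cardsC card_ord.
apply: leq_trans (leq_add (leqnn _) (leA _)).
apply: leq_trans (mxrank_adds_leqif _ _).
rewrite -{1}(mxrank1 F n) mxrankS //.
have := coord_mxU A (~: A) 1%:M; rewrite !mulmx1 setUCr => <-.
by apply/coord_mx_sub => i j; rewrite inE.
Qed.

Variables (r : nat) (M : 'M[F]_(n, r)).

(** The rank function of the matroid on the rows of [M]. With [M] a transposed check matrix, [A] is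
    a set of qubits, that is, of edges. *)
Definition rkset A : nat := \rank (coord_mx A *m M).

Lemma rksetT : rkset [set: 'I_n] = \rank M.
Proof.
rewrite /rkset; congr (\rank _); apply/matrixP => i j.
by rewrite coord_mxE inE mul1r.
Qed.

(** The span for [A :&: B] lies in the intersection of the spans for [A] and [B]; the dimension
    formula does the rest. *)
Lemma rkset_submod A B : (rkset (A :|: B) + rkset (A :&: B) <= rkset A + rkset B)%N.
Proof.
rewrite /rkset coord_mxU -[leqRHS]mxrank_sum_cap leq_add2l.
by apply: mxrankS; rewrite sub_capmx !coord_mxS ?subsetIl ?subsetIr.
Qed.

End RankFunction.

(** * Submodular functions of random sets *)

Section Sampling.
Variables (R : realType) (n : nat) (f : {set 'I_n} -> R).
Hypothesis submod : forall A B, f (A :|: B) + f (A :&: B) <= f A + f B.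
Implicit Types (A D : {set 'I_n}).

Let upto (i : nat) : {set 'I_n} := [set j : 'I_n | (j < i)%N].
Let gain A (j : 'I_n) := f (A :|: upto j.+1) - f (A :|: upto j).

Lemma uptoS (j : 'I_n) : upto j.+1 = j |: upto j.
Proof. by apply/setP => i; rewrite !inE ltnS leq_eqVlt. Qed.

(** Diminishing returns: with the elements of [D] added in increasing order, adding [j] to
    [A :|: (D :&: upto j)] gains at least as much as adding it to the larger set [A :|: upto j]. *)
Lemma submodular_gain A D (i : nat) : (i <= n)%N ->
  f A + \sum_(j < n | (j < i)%N) (j \in D)%:R * gain A j <=
  f (A :|: (D :&: upto i)).
Proof.
elim: i => [|i IHi] lei.
  by rewrite big1 // addr0 [upto 0](_ : _ = set0) ?setI0 ?setU0 //.
pose j := Ordinal lei.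
rewrite (bigD1 j) //= (eq_bigl (fun k : 'I_n => (k < i)%N)); last first.
  by move=> k; rewrite ltnS ltn_neqAle andbC.
rewrite addrCA.
have {}IHi := IHi (ltnW lei).
have uS := uptoS j; rewrite /= in uS.
have [jD|jD] := boolP (j \in D); last first.
  rewrite mul0r add0r uS setIUr.
  rewrite [D :&: [set j]](_ : _ = set0) ?set0U //; apply/setP=> k.
  by rewrite !inE; case: eqP => [->|]; rewrite ?(negbTE jD) ?andbF.
rewrite mul1r /gain /= uS.
have := submod (A :|: (D :&: (j |: upto i))) (A :|: upto i).
rewrite [X in f X + _](_ : _ = A :|: (j |: upto i)); last first.
  apply/setP=> k; rewrite !inE; case: eqP => [->|_] /=; rewrite ?jD ?orbT //.
  by case: (k \in A); case: (k \in D); case: (k < i)%N.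
rewrite [X in _ + f X](_ : _ = A :|: (D :&: upto i)); last first.
  apply/setP=> k; rewrite !inE; case: eqP => [->|_] /=; rewrite ?jD ?ltnn ?andbF ?orbF //.
    by case: (j \in A).
  by case: (k \in A); case: (k \in D); case: (k < i)%N.
by lra.
Qed.

Lemma sum_gain A : \sum_(j < n) gain A j = f [set: 'I_n] - f A.
Proof.
rewrite -(big_mkord xpredT (fun i => f (A :|: upto i.+1) - f (A :|: upto i))).
rewrite telescope_sumr //; congr (f _ - f _); apply/setP => j; rewrite !inE.
  by rewrite ltn_ord orbT.
by rewrite orbF.
Qed.

(** In the mean over [D], each gain in [submodular_gain] gets weight [q], and the gains
    telescope. *)
Lemma submodular_sampling A q : 0 <= q <= 1 ->
  (1 - q) * f A + q * f [set: 'I_n] <= \sum_D bern q D * f (A :|: D).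
Proof.
move=> q01.
have -> : (1 - q) * f A + q * f [set: 'I_n] =
    \sum_D bern q D * (f A + \sum_j (j \in D)%:R * gain A j).
  under eq_bigr => D _ do rewrite mulrDr mulr_sumr.
  rewrite big_split /= -mulr_suml bern_total mul1r exchange_big /=.
  under [X in _ = _ + X]eq_bigr => j _.
    under eq_bigr => D _ do rewrite mulrA.
    rewrite -mulr_suml bern_mem; over.
  by rewrite /= -mulr_sumr sum_gain; ring.
apply: ler_sum => D _; apply: ler_wpM2l; first exact: bern_ge0.
have := submodular_gain A D (leqnn n).
rewrite [upto n](_ : _ = setT) ?setIT; last first.
  by apply/setP => j; rewrite !inE ltn_ord.
by under eq_bigl => j do rewrite ltn_ord.
Qed.

(* A Bernoulli(1 - p) set is the union of independent Bernoulli(p) and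
   Bernoulli((1 - 2p)/(1 - p)) sets. *)
Lemma bern_submodular p : 0 < p -> p <= 1 / 2 ->
  p * (\sum_A bern p A * f A) + (1 - 2 * p) * f [set: 'I_n] <=
  (1 - p) * \sum_A bern (1 - p) A * f A.
Proof.
move=> p0 p12; have p1 : 0 < 1 - p by lra.
have [q qE] : exists q, (1 - p) * q = 1 - 2 * p.
  by exists ((1 - 2 * p) / (1 - p)); rewrite mulrC divfK // gt_eqF.
have q01 : 0 <= q <= 1 by nra.
have := @bern_setU R _ p q f.
have -> : 1 - (1 - p) * (1 - q) = 1 - p by rewrite mulrBr qE; ring.
move=> <-.
apply: (@le_trans _ _ ((1 - p) * \sum_A bern p A * ((1 - q) * f A + q * f [set: 'I_n]))).
  under [X in _ <= _ * X]eq_bigr => A _ do rewrite mulrDr mulrCA.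
  rewrite big_split /= -mulr_sumr -mulr_suml bern_total mul1r mulrDr.
  rewrite !mulrA qE.
  by have -> : (1 - p) * (1 - q) = p by rewrite mulrBr qE; ring.
apply: ler_wpM2l; first exact: ltW.
apply: ler_sum => A _; under eq_bigr => D _ do rewrite -mulrA.
rewrite -mulr_sumr; apply: ler_wpM2l; last exact: submodular_sampling.
by apply: bern_ge0; lra.
Qed.

End Sampling.

(** * Decoding *)

Section Decoding.
Variables (R : realType) (m : nat) (C : css_code m).

Local Notation n := (len C).
Local Notation vec := 'rV['F_2]_n.
Local Notation pauli := (vec * vec)%type.
Implicit Types (A : {set 'I_n}) (x : vec) (E L : pauli).

Lemma suppP x A :
  reflect (forall j, j \notin A -> x 0 j = 0) (supp x \subset A).
Proof.
apply: (iffP subsetP) => [sxA j|x0 j].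
  by apply: contraNeq => xj; apply: sxA; rewrite inE.
by rewrite inE; apply: contraR => /x0 ->.
Qed.

Lemma supp_sub_coord_mx x A : (supp x \subset A) = (x <= coord_mx _ A)%MS.
Proof.
apply/suppP/coord_mx_sub => [x0 i j /x0|x0 j /x0 //].
by rewrite (ord1 i).
Qed.

(** Over the two-element field a vector is determined by its support. *)
Lemma sum_supp (g : {set 'I_n} -> R) : \sum_(x : vec) g (supp x) = \sum_A g A.
Proof.
pose row_of A : vec := \row_j (j \in A)%:R.
have suppK : cancel row_of (@supp m C).
  by move=> A; apply/setP => j; rewrite inE mxE; case: (j \in A).
have rowK : cancel (@supp m C) row_of.
  move=> x; apply/rowP => j; rewrite mxE inE.
  by case: (x 0 j) => [[|[|//]]] ? /=; apply/val_inj.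
by rewrite [RHS](reindex (@supp m C)) //; exists row_of => x _; rewrite ?suppK ?rowK.
Qed.

Lemma erasure_prob_supp (p : R) x : erasure_prob p x = bern p (supp x).
Proof. by apply: eq_bigr => j _; rewrite inE. Qed.

(** The nontrivial logical operators of the code that are supported in [A]. *)
Definition undetected A L : bool :=
  [&& supp L.1 \subset A, supp L.2 \subset A, syndrome L == 0 &
      L \notin stabilizer C].

Definition ambiguous A : bool := [exists L, undetected A L].

Lemma syndromeD E L : syndrome (E + L) = syndrome E + syndrome L.
Proof.
by apply: injective_projections; rewrite /= linearD mulmxDr.
Qed.

Lemma supp_add (x y : vec) A :
  supp x \subset A -> supp y \subset A -> supp (x + y) \subset A.
Proof. by rewrite !supp_sub_coord_mx; exact: addmx_sub. Qed.

Lemma mem_stab_coset E : E \in stab_coset E.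
Proof.
apply/imsetP; exists 0; last by rewrite addr0.
by rewrite inE /= !sub0mx.
Qed.

(* Adding an undetected error maps correctly decoded errors injectively to
   wrongly decoded ones. *)
Lemma ambiguous_wrong (D : decoder C) x : ambiguous (supp x) ->
  (#|erased_errors x| <= 2 * #|wrong_errors D x|)%N.
Proof.
case/existsP => L /and4P[sL1 sL2 /eqP synL stabL].
set W := wrong_errors D x; set Er := erased_errors x.
have WE : W \subset Er by apply/subsetP => E; rewrite inE => /andP[].
rewrite mul2n -addnn -(cardsID W Er) (setIidPr WE) leq_add2l.
rewrite -(card_imset _ (addIr L)); apply: subset_leq_card.
apply/subsetP => _ /imsetP[E + ->]; rewrite !inE.
case/andP => + /andP[sE1 sE2]; rewrite sE1 sE2 /= negbK => /eqP DE.
rewrite !supp_add //= syndromeD synL addr0 DE.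
(* Were [E + L] decoded correctly too, [E] and [E + L] would share a coset, which puts [L] in the
   stabilizer. *)
apply: contra stabL => /eqP cosE; have := mem_stab_coset E.
rewrite cosE => /imsetP[s sstab /eqP]; rewrite -addrA -subr_eq0 opprD addNKr.
rewrite oppr_eq0 addr_eq0 => /eqP ->; move: sstab; rewrite !inE /=.
by rewrite !eqmx_opp.
Qed.

(** By [ambiguous_wrong], every decoder errs with conditional probability at least 1/2 on an
    ambiguous erasure. *)
Lemma Perr_ge (p : R) : 0 <= p <= 1 ->
  \sum_A bern p A * (ambiguous A)%:R <= 2 * Perr C p.
Proof.
move=> p01.
rewrite mulrC -ler_pdivrMr ?ltr0n //; apply: le_bigmin => [|D _].
  (* The default value 1 of the minimum: the left side is a probability. *)
  rewrite ler_pdivrMr ?ltr0n // mul1r.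
  apply: (@le_trans _ _ 1); last by rewrite ler1n.
  rewrite -[leRHS](bern_total 'I_n p); apply: ler_sum => A _.
  by apply: ler_piMr; [exact: bern_ge0 | case: ambiguous].
rewrite ler_pdivrMr ?ltr0n // -(sum_supp (fun A => bern p A * _)) mulr_suml.
apply: ler_sum => x _; rewrite erasure_prob_supp -mulrA.
apply: ler_wpM2l; first exact: bern_ge0.
have [/(ambiguous_wrong D) le2|_] := boolP (ambiguous (supp x)); last first.
  by rewrite mulr_ge0 ?divr_ge0.
have E0 : (0 < #|erased_errors x|)%N.
  apply/card_gt0P; exists 0; rewrite inE /=; apply/andP.
  by split; apply/suppP => j; rewrite mxE.
rewrite mulrAC ler_pdivlMr ?ltr0n // mul1r -natrM ler_nat.
by rewrite mulnC.
Qed.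

Definition rkX A := rkset (HX C)^T A.
Definition rkZ A := rkset (HZ C)^T A.

(** The vectors of the kernel of [H] supported in [A] have dimension [#|A| - rkset H^T A]. They lie
    among the vectors of the row space of [G] that vanish off [A], of dimension
    [\rank G - rkset G^T (~: A)]. *)
Lemma corrected_rank k l (G : 'M['F_2]_(k, n)) (H : 'M['F_2]_(l, n)) A :
  (forall v : vec, supp v \subset A -> H *m v^T = 0 -> (v <= G)%MS) ->
  (#|A| + rkset G^T (~: A) <= rkset H^T A + \rank G)%N.
Proof.
move=> sub.
rewrite -(rank_coord_mx 'F_2 A) -(mxrank_mul_ker (coord_mx _ A) H^T).
rewrite -(mxrank_mul_ker G (coord_mx _ (~: A))) -addnA leq_add2l.
have -> : rkset G^T (~: A) = \rank (G *m coord_mx _ (~: A)).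
  by rewrite -mxrank_tr trmx_mul tr_diag_mx.
rewrite addnC leq_add2l.
apply/mxrankS/row_subP => i; set v := row i _.
have : (v <= coord_mx _ A :&: kermx H^T)%MS by exact: row_sub.
rewrite !sub_capmx => /andP[vA /sub_kermxP vH]; apply/andP; split.
  apply: sub; first by rewrite supp_sub_coord_mx.
  by rewrite -[LHS]trmxK trmx_mul trmxK vH trmx0.
apply/sub_kermxP; rewrite mul_mx_diag; apply/matrixP => a j; rewrite !mxE inE.
move/coord_mx_sub: vA => /(_ a j); rewrite !mxE.
by case: (j \in A) => /= [|->]; rewrite ?mulr0 ?mul0r.
Qed.

(** Errors of pure type, [(v, 0)] and [(0, v)], supply the hypothesis of [corrected_rank]. *)
Lemma unambiguous_rank A : ~~ ambiguous A ->
  (#|A| + rkX (~: A) <= rkZ A + rkX setT)%N /\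
  (#|A| + rkZ (~: A) <= rkX A + rkZ setT)%N.
Proof.
move=> /existsPn amb.
have s0 : supp (0 : vec) \subset A by apply/suppP => j; rewrite mxE.
rewrite /rkX /rkZ !rksetT !mxrank_tr; split; apply: corrected_rank => v sv Hv.
  have := amb (v, 0); rewrite /undetected /= sv s0 /= /syndrome /= Hv.
  by rewrite trmx0 mulmx0 eqxx /= negbK inE /= sub0mx andbT.
have := amb (0, v); rewrite /undetected /= sv s0 /= /syndrome /= Hv.
by rewrite trmx0 mulmx0 eqxx /= negbK inE /= sub0mx.
Qed.

Lemma rate_le (p : R) : 0 < p -> p <= 1 / 2 -> (0 < n)%N ->
  p * rate R C <= (1 - 2 * p) *
    ((\sum_A bern p A * (rkX A + rkZ A)%:R) / n%:R - p) + 4 * (1 - p) * Perr C p.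
Proof.
move=> p0 p12 n0.
have [f fE] : exists f : {set 'I_n} -> R, forall A, f A = (rkX A + rkZ A)%:R.
  by exists (fun A => (rkX A + rkZ A)%:R).
under eq_bigr => A _ do rewrite -fE.
have n0' : 0 < n%:R :> R by rewrite ltr0n.
have p01 : 0 <= p <= 1 by lra.
have submod A B : f (A :|: B) + f (A :&: B) <= f A + f B.
  rewrite !fE -!natrD ler_nat addnACA [leqRHS]addnACA.
  by rewrite leq_add ?rkset_submod.
have fT : f setT = n%:R - n%:R * rate R C.
  rewrite /rate mulrCA divff ?gt_eqF // mulr1 fE /rkX /rkZ !rksetT !mxrank_tr.
  by rewrite natrD; ring.
have := bern_submodular submod p0 p12; rewrite fT.
(* If [A] is unambiguous, add the two inequalities of [unambiguous_rank]; otherwise monotonicity of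
   the ranks and [#|A| <= n] suffice. *)
have bound A : 2 * #|A|%:R + f (~: A) - f A - f setT <= 2 * n%:R * (ambiguous A)%:R.
  have leX : (rkX (~: A) <= rkX setT)%N by apply/mxrankS/coord_mxS/subsetT.
  have leZ : (rkZ (~: A) <= rkZ setT)%N by apply/mxrankS/coord_mxS/subsetT.
  have leA : (#|A| <= n)%N by rewrite -[leqRHS]card_ord max_card.
  have good := @unambiguous_rank A.
  rewrite !fE; move: leX leZ leA good.
  move: (rkX (~: A)) (rkX setT) (rkZ (~: A)) (rkZ setT) (rkX A) (rkZ A) #|A|.
  move=> x' xT z' zT x z a leX leZ leA good.
  apply: (@le_trans _ _ (2 * n * ambiguous A)%:R); last by rewrite !natrM.
  suff : (2 * a + (x' + z') <= 2 * n * ambiguous A + (x + z) + (xT + zT))%N.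
    by rewrite -(ler_nat R) !natrD !natrM; lra.
  by case: ambiguous good => good; [|have [] := good isT]; lia.
have : \sum_A bern p A * (2 * #|A|%:R + f (~: A) - f A - f setT) <=
    2 * n%:R * \sum_A bern p A * (ambiguous A)%:R.
  rewrite mulr_sumr; apply: ler_sum => A _; rewrite [leRHS]mulrCA.
  by apply: ler_wpM2l; [exact: bern_ge0 | exact: bound].
have sumE : \sum_A bern p A * (2 * #|A|%:R + f (~: A) - f A - f setT) =
    2 * (n%:R * p) + \sum_A bern (1 - p) A * f A - \sum_A bern p A * f A - f setT.
  under eq_bigr => A _ do rewrite !mulrDr !mulrN.
  rewrite !big_split /= !sumrN -(bern_setC _ f) -mulr_suml bern_total mul1r.
  congr (_ + _ - _ - _).
  under eq_bigr => A _ do rewrite mulrCA.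
  rewrite -mulr_sumr; congr (_ * _).
  transitivity (\sum_A \sum_(i < n) bern p A * (i \in A)%:R).
    apply: eq_bigr => A _; rewrite -mulr_sumr -natr_sum; congr (_ * _%:R).
    by rewrite -sum1_card big_mkcond; apply: eq_bigr => i _; case: (i \in A).
  rewrite exchange_big /=; under eq_bigr => i _ do rewrite bern_mem.
  by rewrite sumr_const card_ord mulr_natl.
rewrite sumE fT.
have := Perr_ge p01.
set e := \sum_A _ * (ambiguous A)%:R.
set s := \sum_A bern p A * f A; set s' := \sum_A bern (1 - p) A * f A.
move: e s s' (rate R C) (Perr C p) n0' {submod fT bound sumE}.
move: (n%:R) => N e s s' rt P N0 eP h1 h2.
have sE : s = N * (s / N) by rewrite mulrC divfK // gt_eqF.
move: (s / N) sE => d sE; rewrite sE {s sE} in h1 h2 *.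
have h3 : N * e <= N * (2 * P) by rewrite ler_pM2l.
(* The factor [1 - p] lets [s'] be eliminated with the submodularity bound [h1]. *)
have h4 : (1 - p) * (2 * (N * p) + s' - N * d - (N - N * rt)) <=
    (1 - p) * (2 * (N * (2 * P))) by apply: ler_wpM2l; lra.
by rewrite -(ler_pM2l N0); lra.
Qed.

End Decoding.

(** * Components of random subgraphs *)

Section Components.
Variables (r n m : nat) (H : 'M['F_2]_(r, n)).
Hypothesis H_type : type2 H m.
Implicit Types (A : {set 'I_n}) (u v : 'I_r) (e : 'I_n).

Definition incident u : {set 'I_n} := [set e | H u e != 0].

Lemma card_incident u : #|incident u| = m.
Proof. by have /andP[/forallP/(_ u)/eqP] := H_type. Qed.

Lemma joins_sym e u v : joins H e u v = joins H e v u.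
Proof. by rewrite /joins eq_sym [X in _ && X]andbC. Qed.

Lemma edge_ends e : exists u v, joins H e u v /\ [set w | H w e != 0] = [set u; v].
Proof.
have /andP[_ /forallP/(_ e)/cards2P[u [v [uv E]]]] := H_type.
exists u, v; split=> //; rewrite /joins uv /=.
by have := (set21 u v, set22 u v); rewrite -E !inE => -[-> ->].
Qed.

Lemma joins_end e u v w : joins H e u v -> H w e != 0 -> w = u \/ w = v.
Proof.
have [a [b [_ E]]] := edge_ends e.
have inE' x : H x e != 0 -> x = a \/ x = b.
  by move=> xe; have /setP/(_ x) := E; rewrite !inE xe => /esym/orP[]/eqP; auto.
case/and3P => /eqP uv /inE' ue /inE' ve /inE' we.
by move: uv; case: ue => ->; case: ve => ->; case: we => ->; auto.
Qed.

Lemma edge_other u e : H u e != 0 -> exists v, joins H e u v.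
Proof.
move=> ue; have [a [b [ab _]]] := edge_ends e.
have [->|->] := joins_end ab ue; first by exists b.
by exists a; rewrite joins_sym.
Qed.

Definition adj_in A : rel 'I_r := [rel u v | [exists e in A, joins H e u v]].

Lemma adj_in_sym A : connect_sym (adj_in A).
Proof.
apply: sym_connect_sym => u v.
by apply: eq_existsb => e; rewrite joins_sym.
Qed.

(** A component of size s contributes s terms 1/s, and [roots] holds one vertex of each
    component. *)
Lemma sum_inv_component (R : realType) A :
  \sum_u (#|connect (adj_in A) u|%:R)^-1 = #|roots (adj_in A)|%:R :> R.
Proof.
have sym := adj_in_sym A.
rewrite (partition_big (fingraph.root (adj_in A)) (roots (adj_in A))) /=; last first.
  by move=> u _; exact: roots_root.
rewrite -sum1_card natr_sum; apply: eq_bigr => w rw.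
rewrite (eq_bigr (fun=> (#|connect (adj_in A) w|%:R)^-1)); last first.
  move=> u; rewrite -{1}(eqP rw) (root_connect sym) => uw.
  by congr (_%:R^-1); apply: eq_card => x; rewrite !inE; exact: (same_connect sym uw).
rewrite sumr_const.
rewrite (@eq_card _ _ (connect (adj_in A) w)); last first.
  move=> u; rewrite [RHS]inE [RHS]sym -(root_connect sym) (eqP rw).
  by rewrite unfold_in.
rewrite -[_ *+ _]mulr_natl mulfV // pnatr_eq0 -lt0n.
by apply/card_gt0P; exists w; rewrite inE connect0.
Qed.

(** The rows of [K] are the indicators of the components. They are independent, since [N] restricts
    them to the roots and gives the identity, and they annihilate the edges of [A]: both ends lie in
    one component, and 1 + 1 = 0. *)
Lemma rkset_components A : (rkset H^T A + #|roots (adj_in A)| <= r)%N.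
Proof.
set c := #|_|.
pose K : 'M['F_2]_(c, r) := \matrix_(i, v) (connect (adj_in A) (enum_val i) v)%:R.
pose N : 'M['F_2]_(r, c) := \matrix_(v, j) (v == enum_val j)%:R.
have KN : K *m N = 1%:M.
  apply/matrixP => i j; rewrite !mxE (bigD1 (enum_val j)) //= big1 ?addr0.
    rewrite !mxE eqxx mulr1 -(root_connect (adj_in_sym A)).
    have /eqP -> := enum_valP i; have /eqP -> := enum_valP j.
    by rewrite (inj_eq enum_val_inj).
  by move=> v /negbTE vj; rewrite !mxE vj mulr0.
have KH : K *m (coord_mx _ A *m H^T)^T = 0.
  rewrite trmx_mul trmxK tr_diag_mx mulmxA mul_mx_diag.
  apply/matrixP => i e; rewrite !mxE.
  have [eA|_] := boolP (e \in A); last by rewrite mulr0.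
  rewrite mulr1; have [u [v [uv E]]] := edge_ends e.
  have nz w : w \in [set u; v] -> H w e = 1.
    rewrite -E inE; case: (H w e) => [[|[|//]]] //= ? _; exact/val_inj.
  rewrite (bigD1 u) //= (bigD1 v) /=; last by case/and3P: uv; rewrite eq_sym.
  rewrite big1 ?addr0 => [|w /andP[wu wv]]; last first.
    apply/eqP; rewrite mulf_eq0; apply/orP; right; apply: contraTT isT => we.
    have : w \in [set u; v] by rewrite -E inE.
    by rewrite !inE (negbTE wu) (negbTE wv).
  rewrite !nz ?set21 ?set22 // !mulr1 !mxE.
  have /(connect1 (e := adj_in A)) uvA : adj_in A u v.
    by apply/existsP; exists e; rewrite eA.
  have -> : connect (adj_in A) (enum_val i) u = connect (adj_in A) (enum_val i) v.
    by rewrite ![connect _ (enum_val i) _]adj_in_sym (same_connect (adj_in_sym A) uvA).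
  by case: connect => /=; apply/val_inj.
have rK : \rank K = c.
  apply/eqP; rewrite eqn_leq rank_leq_row /=.
  by rewrite -[leqLHS](mxrank1 'F_2) -KN mxrankM_maxl.
rewrite /rkset -mxrank_tr -{1}rK.
have /mxrankS := introT sub_kermxP KH; rewrite mxrank_ker.
have := rank_leq_row (coord_mx 'F_2 A *m H^T)^T.
by move: (\rank _) (\rank _) => a b; lia.
Qed.

End Components.

(** * Covering by the regular tree *)

Section Cover.
Variables (r n m : nat) (H : 'M['F_2]_(r, n)) (v0 : 'I_r).
Hypothesis H_type : type2 H m.
Implicit Types (u v : 'I_r) (e : 'I_n) (c d : 'I_m) (w : seq 'I_m).

Definition port u c : 'I_n :=
  enum_val (cast_ord (esym (card_incident H_type u)) c).

Lemma port_inj u : injective (port u).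
Proof. by move=> c d /enum_val_inj /cast_ord_inj. Qed.

Lemma port_incident u c : H u (port u c) != 0.
Proof.
by have := enum_valP (cast_ord (esym (card_incident H_type u)) c); rewrite inE.
Qed.

Lemma port_surj u e : H u e != 0 -> exists c, port u c = e.
Proof.
move=> ue; have eI : e \in incident H u by rewrite inE.
exists (cast_ord (card_incident H_type u) (enum_rank_in eI e)).
by rewrite /port cast_ordK enum_rankK_in.
Qed.

(** Inverse of [port u]; the default [c] is reached only when [e] is not incident to [u]. *)
Definition port_label u e c : 'I_m := odflt c [pick d | port u d == e].

Lemma port_labelK u e c : H u e != 0 -> port u (port_label u e c) = e.
Proof.
rewrite /port_label => /port_surj[d de]; case: pickP => [x /eqP //|/(_ d)].
by rewrite de eqxx.
Qed.

Definition other_end u e : 'I_r := odflt u [pick v | joins H e u v].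

Lemma other_endP u e : H u e != 0 -> joins H e u (other_end u e).
Proof.
rewrite /other_end => /(edge_other H_type)[v uv].
by case: pickP => [//|/(_ v)]; rewrite uv.
Qed.

(* A word is sent to a vertex of the graph together with a bijective labelling
   by ['I_m] of the edges leaving that vertex; after the step [c] the labelling
   is permuted so that [c] leads back along the edge just used. *)
Fixpoint walk w : 'I_r * ('I_m -> 'I_n) :=
  if w is c :: w' then
    let e := (walk w').2 c in
    let u := other_end (walk w').1 e in
    (u, fun d => port u (tperm c (port_label u e c) d))
  else (v0, port v0).

Definition vtx w : 'I_r := (walk w).1.
Definition exit w : 'I_m -> 'I_n := (walk w).2.

Lemma exit_inj w : injective (exit w).
Proof. by case: w => [|c w] x y /port_inj // /perm_inj. Qed.

Lemma exit_incident w c : H (vtx w) (exit w c) != 0.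
Proof. by case: w => [|d w]; exact: port_incident. Qed.

Lemma joins_cons w c : joins H (exit w c) (vtx w) (vtx (c :: w)).
Proof. exact/other_endP/exit_incident. Qed.

Lemma exit_cons w c : exit (c :: w) c = exit w c.
Proof.
rewrite {1}/exit /= tpermL port_labelK //.
by have /and3P[] := joins_cons w c.
Qed.

(** Left multiplication by the generator [c] in the free product: a repeated letter cancels. *)
Definition nbr w c : seq 'I_m :=
  if w is d :: w' then if d == c then w' else c :: w else [:: c].

Lemma exit_nbr w c : exit (nbr w c) c = exit w c.
Proof.
case: w => [|d w] /=; first exact: exit_cons.
by case: eqP => [->|_]; rewrite exit_cons.
Qed.

(** With [exit_inj], this makes [vtx] a covering: the m edges at a tree vertex go bijectively to
    those at its image. *)
Lemma joins_nbr w c : joins H (exit w c) (vtx w) (vtx (nbr w c)).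
Proof.
case: w => [|d w] /=; first exact: joins_cons.
case: eqP => [->|_]; last exact: joins_cons.
by rewrite joins_sym exit_cons joins_cons.
Qed.

Lemma nbrK (x : tree_vertex m) c : nbr (nbr (val x) c) c = val x.
Proof.
case: x => [[|d w] /= sw]; first by rewrite eqxx.
case: eqP => [<-|_] /=; last by rewrite eqxx.
by case: w sw => //= a w /andP[]; rewrite eq_sym => /negbTE ->.
Qed.

Lemma tree_parent_nbr (x y : tree_vertex m) :
  tree_parent x y -> exists c, val y = nbr (val x) c /\ val x = nbr (val y) c.
Proof.
case: x y => [x sx] [[|c y] sy] //= /eqP /= yx; exists c; rewrite eqxx -yx.
split=> //; case: y {yx} sy => //= d y /andP[].
by rewrite eq_sym => /negbTE ->.
Qed.

Lemma tree_adj_nbr (x y : tree_vertex m) :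
  tree_adj x y -> exists c, val y = nbr (val x) c.
Proof.
by case/orP => /tree_parent_nbr[c []]; exists c.
Qed.

(* A repetition at minimal distance closes a cycle. *)
Lemma repetition_has_cycle (N : nat) (x : nat -> tree_vertex m) (i j : nat) :
  (forall k, (k < N)%N -> tree_adj (x k) (x k.+1)) ->
  {in [pred k | (k <= N)%N] &, injective x} ->
  (i < j <= N)%N -> vtx (val (x i)) = vtx (val (x j)) ->
  exists l, (l <= N)%N /\ has_cycle H l.
Proof.
move=> adj xinj.
have [k] := ubnP (j - i); elim: k i j => // k IH i j jik /andP[ij jN] vij.
have /boolp.choice[c xc] (a : nat) :
    exists b, (a < N)%N -> val (x a.+1) = nbr (val (x a)) b.
  have [aN|Na] := ltnP a N.
    by have [b xb] := tree_adj_nbr (adj _ aN); exists b.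
  by have [b _] := tree_adj_nbr (adj i (leq_trans ij jN)); exists b.
have [[a [b [ia ab bj neq vab]]]|nosmall] := pselect (exists a b : nat,
    [/\ (i <= a)%N, (a < b)%N, (b <= j)%N, (b - a < j - i)%N &
        vtx (val (x a)) = vtx (val (x b))]).
  by apply: (IH a b) => //; [lia | rewrite ab (leq_trans bj)].
have vne a b : (i <= a)%N -> (a < b)%N -> (b <= j)%N -> (b - a < j - i)%N ->
    vtx (val (x a)) <> vtx (val (x b)).
  by move=> ia ab bj lt vab; apply: nosmall; exists a, b.
exists (j - i)%N; split; first by lia.
split; first by rewrite subn_gt0.
pose V (a : 'I_(j - i)) := vtx (val (x (i + a)%N)).
pose E (a : 'I_(j - i)) := exit (val (x (i + a)%N)) (c (i + a)%N).
have JE (a : 'I_(j - i)) : joins H (E a) (V a) (vtx (val (x (i + a).+1))).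
  by have := ltn_ord a => la; rewrite xc; [exact: joins_nbr | lia].
have Vne (a b : 'I_(j - i)) : (a < b)%N -> V a <> V b.
  by move=> ab; have := ltn_ord b => lb; apply: vne; lia.
(* A repeated edge would repeat a vertex too early, unless the two steps are consecutive; then the
   walk backtracks in the tree, against injectivity of [x]. *)
have Ene (a b : 'I_(j - i)) : (a < b)%N -> E a <> E b.
  move=> ab; have := ltn_ord b => lb Eab.
  have : H (V b) (E a) != 0 by rewrite Eab exit_incident.
  case/(joins_end H_type (JE a)) => [/esym|vb]; first exact: Vne.
  have [ab1|ba1] := ltnP a.+1 b.
    by apply: (vne (i + a).+1 (i + b)%N) => //; lia.
  have bE : (i + b = (i + a).+1)%N by lia.
  move: Eab; rewrite /E bE; set s := (i + a)%N in bE *.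
  rewrite -exit_nbr -xc; last by lia.
  move/exit_inj => cE.
  have sN : (s.+1 < N)%N by rewrite -bE; lia.
  have := xc _ sN; rewrite -cE (xc s (ltnW sN)) nbrK => /val_inj/xinj.
  by rewrite !inE sN (ltnW (ltnW sN)) => /(_ isT isT); lia.
exists V, E; split=> [a b vab|a b eab|a].
- apply/val_inj; case: (ltngtP a b) => // [ab|ba]; first by case: (Vne _ _ ab).
  by case: (Vne _ _ ba).
- apply/val_inj; case: (ltngtP a b) => // [ab|ba]; first by case: (Ene _ _ ab).
  by case: (Ene _ _ ba).
have := JE a; congr joins; rewrite /V /=.
(* At the last index the cyclic successor is 0, and [vij] closes the cycle. *)
have [aj|] := ltnP a.+1 (j - i); first by rewrite modn_small // addnS.
have la := ltn_ord a => ja.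
have -> : a.+1 = (j - i)%N by lia.
by rewrite modnn addn0 vij; congr (vtx (val (x _))); lia.
Qed.

Definition parent_vertex (x : tree_vertex m) : tree_vertex m :=
  insubd (tree_root m) (behead (val x)).

Lemma val_parent x : val (parent_vertex x) = behead (val x).
Proof.
rewrite /parent_vertex val_insubd -drop1 drop_sorted //; exact: valP.
Qed.

(** The image of the tree edge from a word to its parent; the root has none. *)
Definition up_edge w : option 'I_n := if w is c :: w' then Some (exit w' c) else None.

(** * Images of small rooted subtrees *)

Section Subtree.
Variables (k : nat) (T : {fset tree_vertex m}).
Hypotheses (subT : rooted_subtree k T) (km : (k < m)%N).
Hypothesis girth : forall l, has_cycle H l -> (m <= l)%N.

Lemma parent_in x : x \in T -> parent_vertex x \in T.
Proof.
move=> xT; have [u uT uE] := subtree_ancestors subT xT 1.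
suff -> : parent_vertex x = u by [].
by apply/val_inj; rewrite val_parent uE drop1.
Qed.

(** Each non-root vertex of [T] owns the edge to its parent. *)
Lemma card_subtree : #|` T| = k.+1.
Proof.
have [rT _ <-] := subT; rewrite (cardfsD1 (tree_root m)) rT add1n; congr _.+1.
have -> : subtree_edges T = [fset (parent_vertex x, x) | x in T `\ tree_root m]%fset.
  apply/fsetP => -[x y]; apply/idP/imfsetP => /=.
    rewrite !inE /= => /andP[/andP[xT yT] /andP[y0 /eqP yx]].
    exists y.
      by rewrite !inE yT andbT; apply: contraNneq y0 => ->.
    by congr pair; apply/val_inj; rewrite val_parent yx.
  move=> [z + [-> ->]]; rewrite !inE /= => /andP[z0 zT].
  rewrite parent_in // zT /tree_parent /= val_parent eqxx andbT.
  by apply: contra_neq z0 => z0; apply/val_inj.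
by rewrite [RHS]card_imfset // => x y [].
Qed.

(** Two vertices with the same image are joined by a simple path in [T], of at most [k < m] edges,
    whose image would contain a cycle shorter than the girth. *)
Lemma vtx_inj : {in T &, injective (fun x : tree_vertex m => vtx (val x))}.
Proof.
move=> x y xT yT /= vxy; have [//|ne] := eqVneq x y.
have [_ conT _] := subT.
have /connectP[p0 pp0 ] := conT [` xT]%fset [` yT]%fset.
case/shortenP: pp0 => p pp up _ yE {p0}.
pose s := [` xT]%fset :: p.
have ss : (size s <= k.+1)%N.
  rewrite -card_subtree -(size_map val); apply: uniq_leq_size.
    by rewrite map_inj_uniq //; exact: val_inj.
  by move=> z /mapP[t _ ->]; exact: fsvalP.
pose X a := val (nth [` xT]%fset s a).
have [l [lp cyc]] : exists l, (l <= size p)%N /\ has_cycle H l.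
  apply: (@repetition_has_cycle (size p) X 0 (size p)).
  - move=> a ap; exact: (pathP [` xT]%fset pp).
  - move=> a b; rewrite !inE => ap bp /val_inj /eqP.
    by rewrite nth_uniq // => /eqP.
  - rewrite leqnn andbT lt0n size_eq0; apply: contra_neq ne => p0.
    by move: yE; rewrite p0 => /(congr1 val).
  by rewrite /X /= nth_last /= -yE.
have := leq_trans (girth cyc) lp; rewrite leqNgt.
by rewrite (leq_ltn_trans _ km) // -ltnS.
Qed.

Definition subtree_vtx : {set 'I_r} := [set u in [seq vtx (val x) | x <- T]].
Definition subtree_edge : {set 'I_n} :=
  [set e | Some e \in [seq up_edge (val x) | x <- T]].
Definition subtree_star : {set 'I_n} := \bigcup_(u in subtree_vtx) incident H u.

Lemma mem_subtree_vtx x : x \in T -> vtx (val x) \in subtree_vtx.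
Proof. by move=> xT; rewrite inE; apply/mapP; exists x. Qed.

Lemma subtree_edgeP e : e \in subtree_edge ->
  exists c x, [/\ x \in T, val x = c :: val (parent_vertex x) &
    e = exit (val (parent_vertex x)) c].
Proof.
rewrite inE => /mapP[x xT]; have pE := val_parent x.
case E : (val x) pE => [//|c w] /= pE [->].
by exists c, x; split=> //; rewrite pE ?E.
Qed.

(** The parent of [x] is either the parent of [y], and the labels agree, or [y] itself, and the word
    of [x] starts with a repeated letter. Membership in [T] is asked of the parent of [x] only,
    because [isolates_subset] deduces that of [x]. *)
Lemma up_edge_eq x y c d : parent_vertex x \in T -> y \in T ->
  val x = c :: val (parent_vertex x) -> val y = d :: val (parent_vertex y) ->
  exit (val (parent_vertex x)) c = exit (val (parent_vertex y)) d -> x = y.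
Proof.
move=> pxT yT xE yE eE.
have := joins_cons (val (parent_vertex y)) d; rewrite -yE -eE => /(joins_end H_type).
case/(_ _ (exit_incident _ c)) => [/vtx_inj pxy|/vtx_inj pxy].
  have {}pxy := pxy pxT (parent_in yT).
  move: eE; rewrite pxy => /exit_inj cd; apply/val_inj.
  by rewrite xE yE pxy cd.
have {}pxy := pxy pxT yT.
move: eE; rewrite pxy -[RHS]exit_cons -yE => /exit_inj cd.
have : sorted [rel a b | a != b] (val x) by exact: valP.
by rewrite xE pxy yE /= cd eqxx.
Qed.

Lemma card_subtree_edge : #|subtree_edge| = k.
Proof.
have [rT _ _] := subT.
have -> : k = size [seq up_edge (val x) | x <- (T `\ tree_root m)%fset].
  by rewrite size_map; have := cardfsD1 (tree_root m) T; rewrite rT card_subtree => -[].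
rewrite cardE -(size_map Some); apply: perm_size; apply: uniq_perm.
- by rewrite map_inj_uniq ?enum_uniq // => a b [].
- rewrite map_inj_in_uniq ?fset_uniq // => x y; rewrite !inE.
  move=> /andP[x0 xT] /andP[y0 yT].
  have xN : val x != [::] by apply: contra_neq x0 => x0; apply/val_inj.
  have yN : val y != [::] by apply: contra_neq y0 => y0; apply/val_inj.
  case xE : (val x) xN => [//|c x'] _; case yE : (val y) yN => [//|d y'] _ [eE].
  have xE' : val x = c :: val (parent_vertex x) by rewrite val_parent xE.
  have yE' : val y = d :: val (parent_vertex y) by rewrite val_parent yE.
  apply: (up_edge_eq (parent_in xT) yT xE' yE').
  by rewrite !val_parent xE yE.
move=> oe; apply/mapP/mapP => [[e]|[x]].
  rewrite mem_enum inE => /mapP[x xT xE] ->; exists x => //.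
  by rewrite !inE xT andbT; apply: contra_eq_neq xE => ->.
rewrite !inE => /andP[x0 xT].
case xE : (val x) => [|c w] /= ->.
  by case/eqP: x0; apply/val_inj.
exists (exit w c) => //; rewrite mem_enum inE; apply/mapP; exists x => //.
by rewrite xE.
Qed.

Lemma card_subtree_vtx : (#|subtree_vtx| <= k.+1)%N.
Proof.
rewrite -card_subtree -(size_map (fun x => vtx (val x))) cardE.
by apply: uniq_leq_size => [|u]; rewrite ?enum_uniq // mem_enum inE.
Qed.

Lemma subtree_edge_joins e : e \in subtree_edge ->
  exists u v, [/\ joins H e u v, u \in subtree_vtx & v \in subtree_vtx].
Proof.
case/subtree_edgeP => c [x [xT xE ->]].
exists (vtx (val (parent_vertex x))), (vtx (val x)).
by rewrite !mem_subtree_vtx ?parent_in //; split=> //; rewrite xE joins_cons.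
Qed.

Lemma subtree_edge_star : subtree_edge \subset subtree_star.
Proof.
apply/subsetP => e /subtree_edge_joins[u [v [/and3P[_ ue _] uV _]]].
by apply/bigcupP; exists u => //; rewrite inE.
Qed.

(** Count incidences with the image vertices: each edge of the star occurs at least once, each image
    edge twice. *)
Lemma card_subtree_star : (#|subtree_star| + k <= m * k.+1)%N.
Proof.
apply: (@leq_trans (m * #|subtree_vtx|)); last by rewrite leq_mul2l card_subtree_vtx orbT.
have -> : (m * #|subtree_vtx| = \sum_e #|[set u in subtree_vtx | H u e != 0%R]|)%N.
  transitivity (\sum_(u in subtree_vtx) \sum_e (H u e != 0%R))%N.
    rewrite mulnC -sum_nat_const; apply: eq_bigr => u _.
    rewrite -[LHS](card_incident H_type u) -sum1_card big_mkcond.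
    by apply: eq_bigr => e _; rewrite inE; case: (H u e != 0).
  rewrite exchange_big; apply: eq_bigr => e _.
  rewrite -sum1_card big_mkcond [RHS]big_mkcond; apply: eq_bigr => u _.
  by rewrite inE; case: (u \in _); case: (H u e != 0).
rewrite -{1}card_subtree_edge -!sum1_card big_mkcond [X in (_ + X)%N]big_mkcond.
rewrite -big_split; apply: leq_sum => e _ /=.
have [eE|_] := boolP (e \in subtree_edge).
  rewrite (subsetP subtree_edge_star) //.
  have [u [v [/and3P[uv ue ve] uV vV]]] := subtree_edge_joins eE.
  rewrite [leqLHS](_ : _ = #|[set u; v]|); last by rewrite cards2 uv.
  apply: subset_leq_card; apply/subsetP => z.
  by case/set2P=> ->; rewrite inE ?uV ?vV.
rewrite addn0; case: ifP => // /bigcupP[u uV]; rewrite inE => ue.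
by apply/card_gt0P; exists u; rewrite inE uV.
Qed.

(** The edges of [A] touching the image of [T] are exactly its image edges, so that this image is a
    whole component. *)
Definition isolates (A : {set 'I_n}) : bool := A :&: subtree_star == subtree_edge.

Lemma isolates_component A : isolates A ->
  (#|connect (adj_in H A) v0| <= k.+1)%N.
Proof.
move/eqP => AE; apply: leq_trans card_subtree_vtx.
have clo : fingraph.closed (adj_in H A) (mem subtree_vtx).
  apply: intro_closed; first exact: adj_in_sym.
  move=> u v /existsP[e /andP[eA uv]] uV.
  have /and3P[_ ue ve] := uv.
  have : e \in subtree_edge.
    by rewrite -AE inE eA; apply/bigcupP; exists u => //; rewrite inE.
  case/subtree_edge_joins => a [b [ab aV bV]].
  by have [->|->] := joins_end H_type ab ve.
apply: subset_leq_card; apply/fintype.subsetP => u; rewrite inE => /(closed_connect clo) <-.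
by have [rT _ _] := subT; exact: (mem_subtree_vtx rT).
Qed.

(** A cylinder event with [k] edges present and at most [m * k.+1 - 2 * k = m + (m - 2) * k]
    absent. *)
Lemma isolates_prob (R : realType) (p : R) : 0 <= p <= 1 -> (2 <= m)%N ->
  (1 - p) ^+ m * (p * (1 - p) ^+ (m - 2)) ^+ k <=
  \sum_A bern p A * (isolates A)%:R.
Proof.
move=> /andP[p0 p1] m2; rewrite bern_cylinder ?subtree_edge_star // card_subtree_edge.
rewrite exprMn -exprM mulrCA -exprD; apply: ler_wpM2l; first exact: exprn_ge0.
apply: ler_wiXn2l; [lra | lra |].
have := card_subtree_star; rewrite mulnS mulnBl; nia.
Qed.

End Subtree.

(** Induction along words: once the parent of [x] is in [T'], the edge to [x] lies in [A] and
    touches the image of [T'], hence is an image edge of [T']. *)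
Lemma isolates_subset k k' T T' A :
  rooted_subtree k T -> rooted_subtree k' T' -> (k' < m)%N ->
  (forall l, has_cycle H l -> (m <= l)%N) ->
  isolates T A -> isolates T' A -> (T `<=` T')%fset.
Proof.
move=> sT sT' km girth /eqP TA /eqP TA'; apply/fsubsetP => x xT.
have [w wx] : exists w, w = val x by exists (val x).
elim: w x xT wx => [|c w IH] x xT xE.
  by have [rT' _ _] := sT'; rewrite (_ : x = tree_root m) //; apply/val_inj.
have pE : val (parent_vertex x) = w by rewrite val_parent -xE.
have pT' : parent_vertex x \in T' by apply: IH; rewrite ?(parent_in sT).
have : exit w c \in subtree_edge T'.
  rewrite -TA' inE; apply/andP; split.
    have : exit w c \in A :&: subtree_star T.
      by rewrite TA inE; apply/mapP; exists x; rewrite -?xE.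
    by rewrite inE => /andP[].
  apply/bigcupP; exists (vtx w); first by rewrite -pE mem_subtree_vtx.
  by rewrite inE exit_incident.
case/subtree_edgeP => d [y [yT' yE eE]].
by rewrite (up_edge_eq sT' km girth pT' yT' _ yE (c := c)) // pE.
Qed.

Lemma isolates_eq k k' T T' A :
  rooted_subtree k T -> rooted_subtree k' T' -> (k < m)%N -> (k' < m)%N ->
  (forall l, has_cycle H l -> (m <= l)%N) ->
  isolates T A -> isolates T' A -> T = T'.
Proof.
move=> sT sT' km km' girth TA TA'; apply/eqP; rewrite eqEfsubset.
by rewrite (isolates_subset sT sT' km' girth TA) ?(isolates_subset sT' sT km girth TA').
Qed.

(** The events [isolates T] are disjoint by [isolates_eq], and on each the component of [v0] has at
    most [k.+1] vertices. *)
Lemma component_ge_Spoly (R : realType) (p : R) : 0 <= p <= 1 -> (2 <= m)%N ->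
  (forall l, has_cycle H l -> (m <= l)%N) ->
  (1 - p) ^+ m * Spoly m (m - 2) (p * (1 - p) ^+ (m - 2)) <=
  \sum_A bern p A * (#|connect (adj_in H A) v0|%:R)^-1.
Proof.
move=> p01 m2 girth.
pose S (k : nat) := fset_set [set T | rooted_subtree (m := m) k T]%classic.
have SP k T : T \in S k -> rooted_subtree k T.
  rewrite in_fset_set; first exact: set_mem.
  exact: rooted_subtrees_finite.
apply: (@le_trans _ _ (\sum_(k < (m - 2).+1) \sum_(T <- S k)
   \sum_A bern p A * ((isolates T A)%:R / k.+1%:R))).
  rewrite /Spoly mulr_sumr; apply: ler_sum => k _.
  have km : (k < m)%N by have := ltn_ord k; lia.
  rewrite mulrCA /num_subtrees -/(S k).
  have -> : #|` S k|%:R / k.+1%:R * ((1 - p) ^+ m * (p * (1 - p) ^+ (m - 2)) ^+ k) =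
     \sum_(T <- S k) ((1 - p) ^+ m * (p * (1 - p) ^+ (m - 2)) ^+ k) / k.+1%:R.
    rewrite big_tnth sumr_const card_ord -[RHS]mulr_natl.
    by rewrite mulrA mulrAC.
  rewrite !big_seq; apply: ler_sum => T /SP sT.
  under eq_bigr => A _ do rewrite mulrA.
  rewrite -mulr_suml; apply: ler_wpM2r; first by rewrite invr_ge0.
  exact: (isolates_prob sT km girth p01 m2).
rewrite (eq_bigr (fun k : 'I__ => \sum_A \sum_(T <- S k)
    bern p A * ((isolates T A)%:R / k.+1%:R))); last first.
  by move=> k _; rewrite exchange_big.
rewrite exchange_big; apply: ler_sum => A _ /=.
under eq_bigr => k _ do rewrite -mulr_sumr.
rewrite -mulr_sumr; apply: ler_wpM2l; first exact: bern_ge0.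
have [[k [T [TS TA]]]|none] := pselect
    (exists (k : 'I_(m - 2).+1) T, T \in S k /\ isolates T A); last first.
  rewrite big1 ?invr_ge0 // => k _; rewrite big_seq big1 // => T TS.
  by have [TA|] := boolP (isolates T A); rewrite ?mul0r //; case: none; exists k, T.
have lt (i : 'I_(m - 2).+1) : (i < m)%N by have := ltn_ord i; lia.
have uniqT (i : 'I_(m - 2).+1) T' : T' \in S i -> isolates T' A -> T' = T /\ i = k.
  move=> T'S T'A.
  have E := isolates_eq (SP _ _ T'S) (SP _ _ TS) (lt i) (lt k) girth T'A TA.
  split=> //; have [_ _ kE] := SP _ _ TS; have [_ _ iE] := SP _ _ T'S.
  by apply/val_inj; rewrite /= -kE -iE E.
rewrite (bigD1 k) //= [X in _ + X]big1 ?addr0; last first.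
  move=> i ik; rewrite big_seq big1 // => T' T'S.
  have [/(uniqT _ _ T'S)[_ E]|] := boolP (isolates T' A); rewrite ?mul0r //.
  by rewrite E eqxx in ik.
rewrite (bigD1_seq T) ?fset_uniq //= big_seq_cond [X in _ + X]big1 ?addr0; last first.
  move=> T' /andP[T'S T'T].
  have [/(uniqT _ _ T'S)[E _]|] := boolP (isolates T' A); rewrite ?mul0r //.
  by rewrite E eqxx in T'T.
rewrite TA mul1r lef_pV2 ?posrE ?ltr0n //; last first.
  by apply/card_gt0P; exists v0; rewrite inE connect0.
by rewrite ler_nat; exact: (isolates_component (SP _ _ TS)).
Qed.

End Cover.

(** * The rate bound *)

(** The rank is at most [r] minus the number of components; counting incidences gives
    [m * r = 2 * n]. *)
Lemma expected_rank_le (R : realType) (r n m : nat) (H : 'M['F_2]_(r, n)) (p : R) :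
  type2 H m -> 0 <= p <= 1 -> (2 <= m)%N ->
  (forall l, has_cycle H l -> (m <= l)%N) ->
  m%:R * (\sum_A bern p A * (rkset H^T A)%:R) <=
  2 * n%:R * (1 - (1 - p) ^+ m * Spoly m (m - 2) (p * (1 - p) ^+ (m - 2))).
Proof.
move=> Ht p01 m2 girth; set X := (1 - p) ^+ m * _.
have rm : (m * r = 2 * n)%N.
  transitivity (\sum_(u < r) \sum_(e < n) (H u e != 0%R))%N.
    rewrite mulnC -[r in LHS]card_ord -sum_nat_const; apply: eq_bigr => u _.
    rewrite -[LHS](card_incident Ht u) -sum1_card big_mkcond.
    by apply: eq_bigr => e _; rewrite inE; case: (H u e != 0).
  rewrite exchange_big mulnC -[n in RHS]card_ord -sum_nat_const /=; apply: eq_bigr => e _.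
  have /andP[_ /forallP/(_ e)/eqP ce] := Ht; rewrite -[RHS]ce.
  rewrite -sum1_card [RHS]big_mkcond; apply: eq_bigr => u _.
  by rewrite inE; case: (H u e != 0).
have -> : 2 * n%:R = m%:R * r%:R :> R by rewrite -!natrM rm.
rewrite -mulrA; apply: ler_wpM2l => //.
have sumX : r%:R * X <= \sum_A bern p A * #|roots (adj_in H A)|%:R.
  under eq_bigr => A _ do rewrite -(sum_inv_component H) mulr_sumr.
  rewrite exchange_big /= mulr_natl -[r in X *+ r]card_ord -sumr_const.
  by apply: ler_sum => v _; exact: (component_ge_Spoly v Ht p01 m2 girth).
rewrite mulrBr mulr1.
apply: (@le_trans _ _ (\sum_A bern p A * (r%:R - #|roots (adj_in H A)|%:R))).
  apply: ler_sum => A _; apply: ler_wpM2l; first exact: bern_ge0.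
  by rewrite lerBrDr -natrD ler_nat; exact: rkset_components Ht A.
under eq_bigr => A _ do rewrite mulrBr.
by rewrite sumrB -mulr_suml bern_total mul1r lerD2l lerN2.
Qed.

(** Ensures that the rate of a proper code has a nonzero denominator. *)
Lemma has_cycle_len (r n l : nat) (H : 'M['F_2]_(r, n)) : has_cycle H l -> (0 < n)%N.
Proof.
by case=> l0 [_ [e _]]; have := ltn_ord (e (Ordinal l0)); case: n {H} e.
Qed.

Lemma proper_rate_le (R : realType) (m : nat) (C : css_code m) (p : R) :
  (2 <= m)%N -> 0 < p -> p <= 1 / 2 -> Defs.proper C ->
  rate R C <= (1 - 2 * p) *
       (4 / (m%:R * p) *
          (1 - (1 - p) ^+ m * Spoly m (m - 2) (p * (1 - p) ^+ (m - 2))) - 1)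
     + 4 * (1 - p) / p * Perr C p.
Proof.
move=> m2 p0 p12 [_ _ [cyc gX] [_ gZ]].
have n0 := has_cycle_len cyc.
have p01 : 0 <= p <= 1 by lra.
have := rate_le p0 p12 n0.
have -> : \sum_A bern p A * (@rkX m C A + @rkZ m C A)%:R =
    (\sum_A bern p A * (@rkX m C A)%:R) + \sum_A bern p A * (@rkZ m C A)%:R.
  rewrite -big_split /=. apply: eq_bigr => A _.
  by rewrite -mulrDr -natrD.
have := expected_rank_le (HX_type C) p01 m2 gX.
have := expected_rank_le (HZ_type C) p01 m2 gZ.
set X := 1 - _ * Spoly _ _ _.
set sX := \sum_A bern p A * (rkX A)%:R.
set sZ := \sum_A bern p A * (rkZ A)%:R.
have : 0 < (len C)%:R :> R by rewrite ltr0n.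
have : 0 < m%:R :> R by rewrite ltr0n; lia.
move: (rate R C) (Perr C p) (len C)%:R m%:R X sX sZ => rt P N M X sX sZ.
move=> M0 N0 hZ hX h.
have le4 : (sX + sZ) / N <= 4 * X / M.
  by rewrite ler_pdivrMr // mulrAC ler_pdivlMr //; lra.
have -> : (1 - 2 * p) * (4 / (M * p) * X - 1) + 4 * (1 - p) / p * P =
    ((1 - 2 * p) * (4 * X / M - p) + 4 * (1 - p) * P) / p.
  by field; rewrite !gt_eqF.
rewrite ler_pdivlMr // mulrC; apply: le_trans h _; rewrite lerD2r.
by apply: ler_wpM2l; lra.
Qed.

Theorem theorem4p7 (R : realType) (m : nat) (p r : R) :
  (2 <= m)%N -> 0 < p -> p <= 1 / 2 ->
  achievable_rate m p r ->
  r <= (1 - 2 * p) *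
       (4 / (m%:R * p) *
          (1 - (1 - p) ^+ m * Spoly m (m - 2) (p * (1 - p) ^+ (m - 2))) - 1).
Proof.
move=> m2 p0 p12 [C [propC cvr cvP]].
set B := (1 - 2 * p) * _.
(* The coefficient of [Perr] does not depend on [i], so the error term vanishes in the limit. *)
have cvB : ((fun i => B + 4 * (1 - p) / p * Perr (C i) p) @ \oo --> (B : R))%classic.
  rewrite -[X in (_ --> X)%classic]addr0 -(mulr0 (4 * (1 - p) / p)).
  by apply: cvgD; [exact: cvg_cst | apply: cvgM; [exact: cvg_cst | exact: cvP]].
apply: (ler_cvg_to cvr cvB); apply: nearW => i /=.
exact: proper_rate_le.
Qed.
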